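(* For $1\le d\le n$, $\mathcal D_d$ is a rational differential operator on $\Omega$ whose poles lie on the locus $\{x\in\Omega: x_i^r=x_j^r\text{ for some }i\ne j\}$ (for $d=1$, $\mathcal D_1=\sum_i\Delta_i$ has no poles on $\Omega$). For all smooth functions $\phi,\eta$ on $\Omega$ (not necessarily invariant under any group), at every point where $\mathcal D_d$ is defined, $$\mathcal D_d(\phi\eta)=(\mathcal D_d\phi)\,\eta+\phi\,(\mathcal D_d\eta).$$
   Context: Let $n,r\ge1$ be integers, $\mathbb{N}_n=\{1,\dots,n\}$, $\Omega=\{x\in\mathbb{C}^n: x_i\ne0\text{ for all }i\}$. On $\Omega$ let $\Delta_i=\frac{1}{r\,x_i^{r-1}}\partial_{x_i}$. For nonempty $I\subseteq\mathbb{N}_n$ let $\mathcal D_I=\sum_{i\in I}\frac{1}{\prod_{j\in I,\,j\ne i}(x_j^r-x_i^r)}\Delta_i$, and for $1\le d\le n$ let $\mathcal D_d=d!\sum_{I\subseteq\mathbb{N}_n,\,|I|=d}\mathcal D_I$. By the standing convention, all functions considered are holomorphic, so ''smooth'' is to be read as holomorphic (complex-differentiable), and $\partial_{x_i}$ is the complex partial derivative. *)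

(* Defs.v *)
From HB Require Import structures.
From mathcomp Require Import all_boot all_order all_algebra.
From mathcomp Require Import fraction complex.
(* The notations of mpoly clash with those of MathComp-Analysis. *)
From mathcomp Require Import -(notations) mpoly.
From mathcomp Require Import boolp classical_sets reals topology normedtype.
From mathcomp Require Import derive.

Set Implicit Arguments.
Unset Strict Implicit.
Unset Printing Implicit Defensive.

Import Order.TTheory GRing.Theory Num.Theory.
Import numFieldNormedType.Exports.

Local Open Scope ring_scope.

(* As a numFieldType, Cplx R carries the topology and norm of MathComp-Analysis*)
Definition Cplx (R : realType) : numFieldType := R[i].

(* The base field K is meant to be Cplx R. Differentials are K-linear, so at  *)
(* K = Cplx R differentiability on the open set Omega is holomorphy.          *)
(* A function on Omega is a total function on K^n; it is only evaluated,      *)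
(* or differentiated, at points of the open set Omega.                        *)

Section Functions.
Context (K : numFieldType) (n : nat).
Implicit Types (x : 'rV[K]_n) (phi : 'rV[K]_n -> K).

Definition Omega x : Prop := forall i : 'I_n, x 0 i != 0.

Definition holomorphic_on_Omega phi : Prop :=
  forall x, Omega x -> differentiable phi x.

Definition partial (i : 'I_n) phi : 'rV[K]_n -> K :=
  fun x => 'D_(delta_mx 0 i) phi x.

(* d^m phi / dx^m; the order of the factors is immaterial for holomorphic phi *)
Definition mpartial (m : multinom n) phi : 'rV[K]_n -> K :=
  foldr (fun i => iter (m i) (partial i)) phi (enum 'I_n).

End Functions.

Section RationalDifferentialOperators.
Context (K : numFieldType) (n : nat).
Implicit Types (x : 'rV[K]_n) (phi : 'rV[K]_n -> K).

Definition ratfun : fieldType := {fraction (mpoly n K)}.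

Definition peval (p : mpoly n K) x : K := meval (fun i => x 0 i) p.

Definition is_value (f : ratfun) x (c : K) : Prop :=
  exists p q : mpoly n K,
    [/\ peval q x != 0, f = tofrac p / tofrac q & c = peval p x / peval q x].

Definition regular_at (f : ratfun) x : Prop := exists c, is_value f x c.

(* 0 where f is not regular; is_value determines c uniquely *)
Definition ratfun_val (f : ratfun) x : K := xget 0 (is_value f x).

(* The operator sum_m c_m d^m/dx^m, of any order, with c_m in K(x_1,...,x_n), *)
(* is encoded by its symbol, the polynomial sum_m c_m X^m over K(x_1,...,x_n).*)
Definition rat_diffop : Type := mpoly n ratfun.

Definition pole (P : rat_diffop) x : Prop :=
  exists m : multinom n, ~ regular_at (mcoeff m P) x.

Definition diffop_act (P : rat_diffop) phi : 'rV[K]_n -> K :=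
  fun x => \sum_(m <- msupp P) ratfun_val (mcoeff m P) x * mpartial m phi x.

End RationalDifferentialOperators.

Section Operators.
Context (K : numFieldType) (n r : nat).
Implicit Types (x : 'rV[K]_n) (phi : 'rV[K]_n -> K) (I : {set 'I_n}).

Definition Delta (i : 'I_n) phi : 'rV[K]_n -> K :=
  fun x => (r%:R * x 0 i ^+ r.-1)^-1 * partial i phi x.

Definition DI_denom I (i : 'I_n) x : K :=
  \prod_(j in I | j != i) (x 0 j ^+ r - x 0 i ^+ r).

Definition DI I phi : 'rV[K]_n -> K :=
  fun x => \sum_(i in I) (DI_denom I i x)^-1 * Delta i phi x.

Definition Dd (d : nat) phi : 'rV[K]_n -> K :=
  fun x => d`!%:R * \sum_(I : {set 'I_n} | #|I| == d) DI I phi x.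

(* 0^-1 = 0 in MathComp, so the formula Dd is meaningful only at these points *)
Definition Dd_defined (d : nat) x : Prop :=
  Omega x /\
  forall I (i : 'I_n), #|I| = d -> i \in I -> DI_denom I i x != 0.

Definition coincidence_locus x : Prop :=
  Omega x /\ exists i j : 'I_n, i != j /\ x 0 i ^+ r = x 0 j ^+ r.

End Operators.

(* Main.v *)
(* Each D_d is a first-order operator sum_i c_i d/dx_i without zeroth-order
   term, so Leibniz' rule for D_d is that of the partial derivatives. The only
   denominators in c_i are r x_i^(r-1), invertible on Omega, and the differences
   x_j^r - x_i^r with j != i, which vanish exactly on the coincidence locus. *)

Require Import Defs.
From mathcomp Require Import all_boot all_order all_algebra.
From mathcomp Require Import fraction.
From mathcomp Require Import -(notations) mpoly.
From mathcomp Require Import boolp classical_sets functions reals topology normedtype.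
From mathcomp Require Import derive.
From mathcomp Require Import ring.

Set Implicit Arguments.
Unset Strict Implicit.
Unset Printing Implicit Defensive.

Import Order.TTheory GRing.Theory Num.Theory.
Import numFieldNormedType.Exports.

Local Open Scope ring_scope.

(** * Values of rational functions at a point *)

Section RationalValues.
Context (K : numFieldType) (n : nat) (x : 'rV[K]_n).
Implicit Types (f g : ratfun K n) (p q : mpoly n K).

Lemma pevalM p q : peval (p * q) x = peval p x * peval q x.
Proof. exact: mevalM. Qed.

Lemma pevalD p q : peval (p + q) x = peval p x + peval q x.
Proof. exact: mevalD. Qed.

Lemma pevalB p q : peval (p - q) x = peval p x - peval q x.
Proof. exact: mevalB. Qed.

Lemma pevalXn p k : peval (p ^+ k) x = peval p x ^+ k.
Proof. exact: (rmorphXn (meval _)). Qed.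

Lemma pevalXU (i : 'I_n) : peval (mpolyX K (mnm1 i)) x = x 0 i.
Proof. exact: mevalXU. Qed.

Lemma peval_nat k : peval k%:R x = k%:R.
Proof. exact: (rmorph_nat (meval _)). Qed.

Lemma peval_neq0 p : peval p x != 0 -> p != 0.
Proof. by apply: contraNneq => ->; rewrite /peval meval0. Qed.

Lemma tofrac_neq0 p : peval p x != 0 -> tofrac p != 0.
Proof. by move=> /peval_neq0; rewrite -tofrac_eq tofrac0. Qed.

(** Cross-multiplying two fractions for [f] gives an identity of polynomials, as [tofrac] is
    injective; evaluating it at [x] and dividing by the nonzero denominators gives the claim. *)
Lemma is_value_inj f c1 c2 : is_value f x c1 -> is_value f x c2 -> c1 = c2.
Proof.
move=> [p1 [q1 [q1N0 -> ->]]] [p2 [q2 [q2N0 /eqP + ->]]].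
rewrite eqr_div ?tofrac_neq0// -!tofracM tofrac_eq => /eqP /(congr1 (fun p => peval p x)).
by rewrite /= !pevalM => e; apply/eqP; rewrite eqr_div// e.
Qed.

Lemma is_value_ratfun_val f c : is_value f x c -> ratfun_val f x = c.
Proof. by move=> fc; apply: xget_unique => // d; move/is_value_inj; apply. Qed.

Lemma is_value_tofrac p : is_value (tofrac p) x (peval p x).
Proof.
have one : peval 1 x = 1 by exact: meval1.
by exists p, 1; rewrite one oner_neq0 tofrac1 !divr1.
Qed.

Lemma is_value_nat k : is_value k%:R x k%:R.
Proof.
have := is_value_tofrac k%:R.
by rewrite peval_nat (rmorph_nat (@tofrac (mpoly n K))).
Qed.

Lemma is_valueD f g a b :
  is_value f x a -> is_value g x b -> is_value (f + g) x (a + b).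
Proof.
move=> [p1 [q1 [q1N0 -> ->]]] [p2 [q2 [q2N0 -> ->]]].
exists (p1 * q2 + p2 * q1), (q1 * q2).
rewrite pevalD !pevalM tofracD !tofracM mulf_neq0//.
by rewrite -!addf_div// tofrac_neq0.
Qed.

Lemma is_valueM f g a b :
  is_value f x a -> is_value g x b -> is_value (f * g) x (a * b).
Proof.
move=> [p1 [q1 [q1N0 -> ->]]] [p2 [q2 [q2N0 -> ->]]].
exists (p1 * p2), (q1 * q2).
by rewrite !pevalM !tofracM mulf_neq0// !mulf_div.
Qed.

(** A nonzero value means a numerator that does not vanish at [x], so it may serve as the
    denominator of the inverse. *)
Lemma is_valueV f a : a != 0 -> is_value f x a -> is_value f^-1 x a^-1.
Proof.
move=> aN0 [p [q [qN0 -> ea]]]; exists q, p.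
split; rewrite ?ea ?invf_div//.
by move: aN0; rewrite ea mulf_eq0 negb_or => /andP[].
Qed.

Lemma is_value_sum (T : finType) (P : pred T) (F : T -> ratfun K n) a :
  (forall t, P t -> is_value (F t) x (a t)) ->
  is_value (\sum_(t | P t) F t) x (\sum_(t | P t) a t).
Proof.
move=> Fa; elim/big_rec2: _ => [|t b g Pt gb]; first exact: is_value_nat 0%N.
by apply: is_valueD => //; apply: Fa.
Qed.

Lemma is_value_prod (T : finType) (P : pred T) (F : T -> ratfun K n) a :
  (forall t, P t -> is_value (F t) x (a t)) ->
  is_value (\prod_(t | P t) F t) x (\prod_(t | P t) a t).
Proof.
move=> Fa; elim/big_rec2: _ => [|t b g Pt gb]; first exact: is_value_nat 1%N.
by apply: is_valueM => //; apply: Fa.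
Qed.

End RationalValues.

(** * First-order operators and their symbols *)

Section FirstOrder.
Context (K : numFieldType) (n : nat).
Implicit Types (phi eta : 'rV[K]_n -> K) (c : 'I_n -> ratfun K n).

Lemma partialM (i : 'I_n) phi eta x :
    differentiable phi x -> differentiable eta x ->
  partial i (fun y => phi y * eta y) x =
    partial i phi x * eta x + phi x * partial i eta x.
Proof.
move=> dphi deta; rewrite /partial.
have -> : (fun y => phi y * eta y) = phi * eta by [].
rewrite deriveM; [|exact: diff_derivable..].
by rewrite addrC [_ *: _]mulrC.
Qed.

(** The product rule is applied term by term. The coefficients are scalars frozen at [x], so the
    lemma serves both the explicit formula and the rational operator. *)
Lemma leibniz_first_order (a : 'I_n -> K) phi eta x :
    differentiable phi x -> differentiable eta x ->
  \sum_i a i * partial i (fun y => phi y * eta y) x =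
    (\sum_i a i * partial i phi x) * eta x +
    phi x * \sum_i a i * partial i eta x.
Proof.
move=> dphi deta; rewrite mulr_suml mulr_sumr -big_split /=.
by apply: eq_bigr => i _; rewrite partialM//; ring.
Qed.

Lemma mpartial_mnm1 (i : 'I_n) phi : mpartial (mnm1 i) phi = partial i phi.
Proof.
rewrite /mpartial.
(* The induction needs an arbitrary duplicate-free list: only the entry [i] has exponent 1, so the
   fold differentiates once if [i] occurs and not at all otherwise. *)
suff fE s : uniq s -> foldr (fun j => iter (mnm1 i j) (partial j)) phi s =
    if i \in s then partial i phi else phi.
  by rewrite fE ?enum_uniq// mem_enum.
elim: s => //= j s IHs /andP[jNs us]; rewrite IHs// mnm1E in_cons.
by case: eqVneq => [->|_] //=; rewrite (negbTE jNs).
Qed.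

Definition first_order_op c : rat_diffop K n :=
  \sum_i c i *: mpolyX (ratfun K n) (mnm1 i).

Lemma mcoeff_first_order_op c m :
  mcoeff m (first_order_op c) = \sum_i c i * (mnm1 i == m)%:R.
Proof.
rewrite /first_order_op raddf_sum /=.
by apply: eq_bigr => i _; rewrite mcoeffZ mcoeffX.
Qed.

Lemma mcoeff_first_order_op1 c (i : 'I_n) :
  mcoeff (mnm1 i) (first_order_op c) = c i.
Proof.
rewrite mcoeff_first_order_op (bigD1 i)//= eqxx mulr1 big1 ?addr0// => j ji.
by rewrite eq_mnm1 (negbTE ji) mulr0.
Qed.

Lemma mcoeff_first_order_op0 c m :
  m \notin [seq mnm1 i | i : 'I_n] -> mcoeff m (first_order_op c) = 0.
Proof.
move=> mN; rewrite mcoeff_first_order_op big1// => i _.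
by case: eqVneq mN => [<- /negP[]|_ _]; [rewrite map_f ?mem_enum | exact: mulr0].
Qed.

(** The support of the symbol omits every [mnm1 i] with [c i = 0]. The missing terms can be restored
    because the zero fraction has value 0 at every point. *)
Lemma diffop_act_first_order_op c phi x :
  diffop_act (first_order_op c) phi x =
    \sum_i ratfun_val (c i) x * partial i phi x.
Proof.
rewrite /diffop_act; set P := first_order_op c; set F := BIG_F.
have F0 m : m \notin msupp P -> F m = 0.
  move=> /memN_msupp_eq0; rewrite /F => ->.
  by rewrite (is_value_ratfun_val (is_value_nat x 0)) mul0r.
pose s := [seq mnm1 i | i : 'I_n].
have us : uniq s.
  by rewrite map_inj_uniq ?enum_uniq// => i j /eqP; rewrite eq_mnm1 => /eqP.
(* The support contains only monomials of degree one, so it is, up to order, a sublist of [s]. *)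
have Ps : perm_eq (msupp P) [seq m <- s | m \in msupp P].
  apply: uniq_perm; rewrite ?filter_uniq ?msupp_uniq// => m.
  rewrite mem_filter; case: (boolP (m \in msupp P)) => //=.
  by rewrite mcoeff_msupp; apply: contraNeq => /mcoeff_first_order_op0 ->.
rewrite (perm_big _ Ps) /= big_filter big_mkcond /= (eq_bigr F) => [|m _]; last first.
  by case: ifPn => // /F0.
rewrite big_map big_enum /=; apply: eq_bigr => i _.
by rewrite /F mcoeff_first_order_op1 mpartial_mnm1.
Qed.

(** All coefficients other than the [c i] are 0, hence regular everywhere. *)
Lemma pole_first_order_op c x :
  pole (first_order_op c) x -> exists i, ~ regular_at (c i) x.
Proof.
move=> [m]; case: (boolP (m \in [seq mnm1 i | i : 'I_n])).
  by move=> /mapP[i _ ->]; rewrite mcoeff_first_order_op1; exists i.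
move=> /mcoeff_first_order_op0 -> []; exists 0; exact: is_value_nat x 0%N.
Qed.

End FirstOrder.

(** * The coefficients of $\mathcal D_d$, as functions and as fractions *)

Section Coefficients.
Context (K : numFieldType) (n r d : nat).
Implicit Types (x : 'rV[K]_n) (i : 'I_n) (phi : 'rV[K]_n -> K).

Definition Dd_coef i x : K :=
  d`!%:R * (\sum_(I : {set 'I_n} | (#|I| == d) && (i \in I))
    (DI_denom r I i x)^-1) * (r%:R * x 0 i ^+ r.-1)^-1.

(** Exchanging the sums over [I] and over [i] in [I] collects all terms in [partial i]; inverses are
    carried along without being simplified. *)
Lemma Dd_first_order phi x :
  Dd r d phi x = \sum_i Dd_coef i x * partial i phi x.
Proof.
rewrite /Dd /DI /Dd_coef /Delta (exchange_big_dep predT)//= mulr_sumr.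
apply: eq_bigr => i _; rewrite -!mulrA; congr (_ * _).
by rewrite mulr_suml.
Qed.

(** The expression [Dd_coef] with indeterminates in place of coordinates, so that its value can be
    computed factor by factor. *)
Definition Dd_coef_frac i : ratfun K n :=
  d`!%:R * (\sum_(I : {set 'I_n} | (#|I| == d) && (i \in I))
    (\prod_(j in I | j != i)
      tofrac (mpolyX K (mnm1 j) ^+ r - mpolyX K (mnm1 i) ^+ r))^-1) *
  (tofrac (r%:R * mpolyX K (mnm1 i) ^+ r.-1))^-1.

Lemma is_value_Dd_coef i x : (0 < r)%N -> Dd_defined r d x ->
  is_value (Dd_coef_frac i) x (Dd_coef i x).
Proof.
move=> r_gt0 [Ox denN0]; apply: is_valueM; first apply: is_valueM.
- exact: is_value_nat.
- apply: is_value_sum => I /andP[/eqP cI iI].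
  apply: is_valueV; first exact: denN0.
  apply: is_value_prod => j _.
  by rewrite -2!(pevalXU x) -!pevalXn -pevalB; exact: is_value_tofrac.
(* Here [r] is nonzero in [K], of characteristic 0, and [x 0 i] is nonzero on [Omega]. *)
- apply: is_valueV; first by rewrite mulf_neq0 ?expf_neq0 ?pnatr_eq0 -?lt0n.
  by rewrite -(pevalXU x) -pevalXn -(peval_nat x) -pevalM; exact: is_value_tofrac.
Qed.

Lemma Dd_defined_not_pole x : (0 < r)%N -> Dd_defined r d x ->
  ~ pole (first_order_op Dd_coef_frac) x.
Proof.
move=> r_gt0 Dx px; have [i iN] := pole_first_order_op px; apply: iN.
by exists (Dd_coef i x); exact: is_value_Dd_coef.
Qed.

(** By contraposition: if the powers [x 0 i ^+ r] are pairwise distinct, every factor of every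
    [DI_denom] is nonzero. *)
Lemma Dd_definedPn x : Omega x -> ~ Dd_defined r d x -> coincidence_locus r x.
Proof.
move=> Ox nD; split=> //; apply: contrapT => nc; apply: nD; split=> // I i _ _.
apply/prodf_neq0 => j /andP[_ ji]; rewrite subr_eq0; apply/eqP => e.
by apply: nc; exists j, i.
Qed.

End Coefficients.

(** * The case $d=1$, where each [I] is a singleton and its denominator an empty product *)

Lemma DI_denom1 (K : numFieldType) (n r : nat) (i : 'I_n) (x : 'rV[K]_n) :
  DI_denom r [set i] i x = 1.
Proof. by rewrite /DI_denom big1// => j; rewrite inE andbN. Qed.

Lemma Dd_defined1 (K : numFieldType) (n r : nat) (x : 'rV[K]_n) :
  Omega x -> Dd_defined r 1 x.
Proof.
move=> Ox; split=> // I i /eqP/cards1P[k ->] /set1P ->.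
by rewrite DI_denom1 oner_neq0.
Qed.

Lemma Dd1E (K : numFieldType) (n r : nat) (phi : 'rV[K]_n -> K) x :
  Dd r 1 phi x = \sum_i Delta r i phi x.
Proof.
rewrite Dd_first_order; apply: eq_bigr => i _; rewrite /Dd_coef /Delta.
rewrite (big_pred1 [set i]) => [|I]; first by rewrite DI_denom1 invr1 !mul1r.
apply/andP/eqP => [[/cards1P[k ->] /set1P ->]//|->].
by rewrite cards1 set11.
Qed.

Theorem proposition5p3 (R : realType) (n r d : nat)
    (n_gt0 : (0 < n)%N) (r_gt0 : (0 < r)%N) (d_gt0 : (0 < d)%N)
    (d_le_n : (d <= n)%N) :
  (exists P : rat_diffop (Cplx R) n,
    [/\ (* P is the operator D_d *)
        forall phi : 'rV[Cplx R]_n -> Cplx R, holomorphic_on_Omega phi ->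
          forall x, Dd_defined r d x -> Dd r d phi x = diffop_act P phi x,
        forall x : 'rV[Cplx R]_n, Omega x -> pole P x -> coincidence_locus r x,
        d = 1%N -> forall x : 'rV[Cplx R]_n, Omega x -> ~ pole P x
      & forall phi eta : 'rV[Cplx R]_n -> Cplx R,
          holomorphic_on_Omega phi -> holomorphic_on_Omega eta ->
          forall x, Omega x -> ~ pole P x ->
            diffop_act P (fun y => phi y * eta y) x =
              diffop_act P phi x * eta x + phi x * diffop_act P eta x])
  /\ (d = 1%N -> forall phi : 'rV[Cplx R]_n -> Cplx R, holomorphic_on_Omega phi ->
        forall x, Omega x -> Dd r d phi x = \sum_(i < n) Delta r i phi x)
  /\ (forall phi eta : 'rV[Cplx R]_n -> Cplx R,
        holomorphic_on_Omega phi -> holomorphic_on_Omega eta ->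
        forall x, Dd_defined r d x ->
          Dd r d (fun y => phi y * eta y) x =
            Dd r d phi x * eta x + phi x * Dd r d eta x).
Proof.
split; [|split].
(* The witness has the fractions [Dd_coef_frac] as coefficients; their values are those of [Dd_coef]
   wherever $\mathcal D_d$ is defined. *)
- exists (first_order_op (@Dd_coef_frac _ n r d)); split.
  + move=> phi _ x Dx; rewrite Dd_first_order diffop_act_first_order_op.
    apply: eq_bigr => i _; congr (_ * _).
    by rewrite (is_value_ratfun_val (is_value_Dd_coef i r_gt0 Dx)).
  (* A point off the coincidence locus has all denominators nonzero, so it cannot be a pole. *)
  + by move=> x Ox px; apply: (@Dd_definedPn _ _ _ d) => // Dx;
    exact: Dd_defined_not_pole px.
  + by move=> d1 x Ox; apply: Dd_defined_not_pole => //; rewrite d1; exact: Dd_defined1.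
  (* This is Leibniz' rule at all regular points of the rational operator; by [Dd_defined_not_pole]
     they include the points where the formula [Dd] is defined. *)
  + move=> phi eta hphi heta x Ox _; rewrite !diffop_act_first_order_op.
    by apply: leibniz_first_order; [exact: hphi | exact: heta].
- by move=> -> phi _ x _; exact: Dd1E.
- move=> phi eta hphi heta x [Ox _]; rewrite !Dd_first_order.
  by apply: leibniz_first_order; [exact: hphi | exact: heta].
Qed.
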